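(* Let $\alpha>0$ and let $\boldsymbol{X}$ be an $n\times p$ random data matrix with independent entries, $X_{ij}$ having density $g_{ij}$. If $\boldsymbol{\theta}^g=(\lambda^g,\{u_i^g\}_{i=1}^n,\{v_j^g\}_{j=1}^p,(\sigma^g)^2)$ is a ''best'' fitting parameter for the matrix $\boldsymbol{X}$, then for any real constant $c\neq0$, $\widetilde{\boldsymbol{\theta}}^g=(c\lambda^g,\{u_i^g\}_{i=1}^n,\{v_j^g\}_{j=1}^p,(c\sigma^g)^2)$ is a ''best'' fitting parameter for the matrix $c\boldsymbol{X}$.
   Context: $f$ is a known probability density on $\mathbb{R}$ with $f(x)=f(-x)$, $M_f=\int f^{1+\alpha}$, and $$V_f(x;a,b,\sigma^2)=\sigma^{-\alpha}\Big[M_f-\Big(1+\frac1\alpha\Big)f^\alpha\Big(\Big|\frac{x-ab}{\sigma}\Big|\Big)\Big].$$ ''Best'' fitting parameter: let $\boldsymbol{X}$ be an $n\times p$ random matrix with independent entries, $X_{ij}$ having density $g_{ij}$. A tuple $\boldsymbol{\theta}^g=(\lambda^g,\{u_i^g\}_{i=1}^n,\{v_j^g\}_{j=1}^p,(\sigma^g)^2)$ (with $\lambda^g,u_i^g,v_j^g$ real and $\sigma^g>0$) is called a ''best'' fitting parameter for $\boldsymbol{X}$ if 1. $\sum_{i=1}^n(u_i^g)^2=1$ and $\sum_{j=1}^p(v_j^g)^2=1$; 2. for all $i,j$: $\lambda^gu_i^g=\arg\min_{a\in\mathbb{R}}\int V_f(x;a,v_j^g,(\sigma^g)^2)\,g_{ij}(x)\,dx$;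 3. for all $i,j$: $\lambda^gv_j^g=\arg\min_{b\in\mathbb{R}}\int V_f(x;u_i^g,b,(\sigma^g)^2)\,g_{ij}(x)\,dx$; 4. for all $i,j$: $(\sigma^g)^2=\arg\min_{\sigma^2>0}\int V_f(x;\lambda^gu_i^g,v_j^g,\sigma^2)\,g_{ij}(x)\,dx=\arg\min_{\sigma^2>0}\int V_f(x;u_i^g,\lambda^gv_j^g,\sigma^2)\,g_{ij}(x)\,dx$. Here ''$=\arg\min$'' means that the left-hand side is a minimizer. *)

(* Defs.v *)
From HB Require Import structures.
From mathcomp Require Import all_boot all_order all_algebra.
From mathcomp Require Import all_classical all_reals all_analysis.

Set Implicit Arguments.
Unset Strict Implicit.
Unset Printing Implicit Defensive.

Import Order.TTheory GRing.Theory Num.Theory.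
Import numFieldNormedType.Exports.

Local Open Scope classical_set_scope.
Local Open Scope ring_scope.

Definition prob_density (R : realType) (g : R -> R) : Prop :=
  [/\ measurable_fun [set: R] g,
      forall x, 0 <= g x &
      (\int[@lebesgue_measure R]_(x in [set: R]) (g x)%:E = 1)%E].

Definition has_density (R : realType) (d : measure_display)
    (T : measurableType d) (P : probability T R) (Y : T -> R) (g : R -> R)
    : Prop :=
  [/\ measurable_fun [set: T] Y,
      prob_density g &
      forall A : set R, measurable A ->
        (P (Y @^-1` A) = \int[@lebesgue_measure R]_(x in A) (g x)%:E)%E].

(* Taking some of the A i j to be the whole line gives the product rule for
   every subfamily of entries. *)
Definition independent_entries (R : realType) (d : measure_display)
    (T : measurableType d) (P : probability T R) (n p : nat)
    (X : T -> 'M[R]_(n, p)) : Prop :=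
  forall A : 'I_n -> 'I_p -> set R,
    (forall i j, measurable (A i j)) ->
    (P [set w | forall i j, A i j (X w i j)] =
     \prod_(i < n) \prod_(j < p) P [set w | A i j (X w i j)])%E.

Definition random_matrix_with_densities (R : realType) (d : measure_display)
    (T : measurableType d) (P : probability T R) (n p : nat)
    (X : T -> 'M[R]_(n, p)) (g : 'I_n -> 'I_p -> R -> R) : Prop :=
  independent_entries P X /\
  forall i j, has_density P (fun w => X w i j) (g i j).

(* M_f and V_f take extended real values, so that no integrability assumption
   on f ^ (1 + alpha) is needed to make sense of them. *)
Definition M_f (R : realType) (f : R -> R) (alpha : R) : \bar R :=
  (\int[@lebesgue_measure R]_(x in [set: R]) (f x `^ (1 + alpha))%:E)%E.

(* sigma2 stands for sigma ^ 2; it is only used for sigma2 > 0. *)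
Definition V_f (R : realType) (f : R -> R) (alpha x a b sigma2 : R) : \bar R :=
  let sigma := Num.sqrt sigma2 in
  ((sigma `^ (- alpha))%:E *
   (M_f f alpha -
    ((1 + alpha^-1) * f `|(x - a * b) / sigma| `^ alpha)%:E))%E.

Definition int_V_f (R : realType) (f : R -> R) (alpha : R) (g : R -> R)
    (a b sigma2 : R) : \bar R :=
  (\int[@lebesgue_measure R]_(x in [set: R])
     (V_f f alpha x a b sigma2 * (g x)%:E))%E.

Definition is_argmin (R : realType) (D : set R) (F : R -> \bar R) (x : R)
    : Prop :=
  D x /\ forall y, D y -> (F x <= F y)%E.

Record parameter (R : realType) (n p : nat) := Theta {
  theta_lambda : R;
  theta_u : 'I_n -> R;
  theta_v : 'I_p -> R;
  theta_sigma2 : R }.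

(* The densities of the entries of X are determined almost everywhere, so the
   integrals do not depend on the choice of g. *)
Definition best_fitting (R : realType) (d : measure_display)
    (T : measurableType d) (P : probability T R) (n p : nat)
    (f : R -> R) (alpha : R) (X : T -> 'M[R]_(n, p)) (theta : parameter R n p)
    : Prop :=
  exists g : 'I_n -> 'I_p -> R -> R,
    random_matrix_with_densities P X g /\
    let: Theta l u v s2 := theta in
    [/\ 0 < s2,
        \sum_(i < n) u i ^+ 2 = 1 /\ \sum_(j < p) v j ^+ 2 = 1,
        forall i j, is_argmin [set: R]
          (fun a => int_V_f f alpha (g i j) a (v j) s2) (l * u i),
        forall i j, is_argmin [set: R]
          (fun b => int_V_f f alpha (g i j) (u i) b s2) (l * v j) &
        forall i j,
          is_argmin [set t | 0 < t]
            (fun t => int_V_f f alpha (g i j) (l * u i) (v j) t) s2 /\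
          is_argmin [set t | 0 < t]
            (fun t => int_V_f f alpha (g i j) (u i) (l * v j) t) s2].

(* Main.v *)
Require Import Defs.
From HB Require Import structures.
From mathcomp Require Import all_boot all_order all_algebra.
From mathcomp Require Import all_classical all_reals all_analysis.
From mathcomp Require Import measurable_realfun.

(** Everything follows from how the objective behaves under the dilation
    [x |-> c x].  If [Y] has density [g], then [c Y] has density
    [g_c x = |c|^-1 g (x / c)] ([dilated_density]).  The residual
    [(x - a b) / sigma] keeps its absolute value when [x], the product [a b]
    and [sigma] are multiplied by [c], [c] and [|c|], so that only the
    prefactor of [V_f] changes ([V_f_dilation]):
      [V_f (c x; c a, b, c^2 s) = |c|^-alpha V_f (x; a, b, s)].
    The substitution [y = c x] ([integral_dilation]) then gives
      [int V_f (y; c a, b, c^2 s) g_c y dy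
         = |c|^-alpha int V_f (x; a, b, s) g x dx]
    ([int_V_f_dilation]), and the same with [b] in place of [a], as only the
    product [a b] matters.  Each objective for [c X] is thus a positive
    multiple of the one for [X], reparametrized by [a |-> a / c],
    [b |-> b / c] or [s |-> s / c^2]; a minimizer of the latter yields a
    minimizer of the former ([is_argmin_scale]).

    The integrals of [V_f g] may be infinite, so the change of variables and
    the extraction of a positive constant are proved for arbitrary measurable
    extended real-valued functions, through the positive and negative
    parts. *)

Set Implicit Arguments.
Unset Strict Implicit.
Unset Printing Implicit Defensive.

Import Order.TTheory GRing.Theory Num.Theory.
Import numFieldNormedType.Exports.

Local Open Scope classical_set_scope.
Local Open Scope ring_scope.

(** * Integrals and dilations of the line *)

Section dilation.
Context {R : realType}.
Local Notation mu := (@lebesgue_measure R).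

Lemma measurable_preimage_mull (c : R) (A : set R) : measurable A ->
  measurable (( *%R c) @^-1` A).
Proof.
move=> mA; rewrite -[X in measurable X]setTI.
exact: mulrl_measurable.
Qed.

Lemma preimage_mull_itvoc_gt0 (c a b : R) : 0 < c ->
  ( *%R c) @^-1` `]a, b]%classic = `]a / c, b / c]%classic.
Proof.
move=> c0; apply/seteqP; split=> x /=;
  by rewrite !in_itv/= ltr_pdivrMr// ler_pdivlMr// ![x * c]mulrC.
Qed.

Lemma preimage_mull_itvoc_lt0 (c a b : R) : c < 0 ->
  ( *%R c) @^-1` `]a, b]%classic = `[b / c, a / c[%classic.
Proof.
move=> c0; apply/seteqP; split=> x /=;
  by rewrite !in_itv/= ltr_ndivlMr// ler_ndivrMr// ![x * c]mulrC andbC.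
Qed.

(** Both sides are measures in [A], so it suffices to compare them on the
    intervals [`]a, b]]; their preimage is again an interval, reversed when
    [c < 0]. *)
Lemma lebesgue_measure_dilation (c : R) (A : set R) : c != 0 ->
  measurable A -> mu A = (`|c|%:E * mu (( *%R c) @^-1` A))%E.
Proof.
move=> c0 mA.
pose phi : measurableTypeR R -> measurableTypeR R := *%R c.
have mphi : measurable_fun [set: measurableTypeR R] phi.
  exact: mulrl_measurable.
pose k : {nonneg R} := NngNum (normr_ge0 c).
apply: (@lebesgue_measure_unique _ (mscale k (pushforward mu phi))) => //=.
move=> _ [[a b]] _ <-.
rewrite -[RHS]/(`|c|%:E * mu (( *%R c) @^-1` `]a, b]%classic))%E.
case/lt_total/orP: c0 => c0.
  rewrite preimage_mull_itvoc_lt0// !lebesgue_measure_itv/= !lte_fin.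
  rewrite ltr_nM2r ?invr_lt0//; case: ifPn => _; last by rewrite mule0.
  rewrite -!EFinD -EFinM ltr0_norm//; congr EFin.
  by rewrite -mulrBl mulNr mulrCA divff ?lt_eqF// mulr1 opprB.
rewrite preimage_mull_itvoc_gt0// !lebesgue_measure_itv/= !lte_fin.
rewrite ltr_pM2r ?invr_gt0//; case: ifPn => _; last by rewrite mule0.
rewrite -!EFinD -EFinM gtr0_norm//; congr EFin.
by rewrite -mulrBl mulrCA divff ?gt_eqF// mulr1.
Qed.

Lemma ge0_integral_dilation (c : R) (A : set R) (F : R -> \bar R) : c != 0 ->
  measurable A -> measurable_fun [set: R] F -> (forall x, 0 <= F x)%E ->
  (\int[mu]_(x in A) F x =
   \int[mu]_(x in ( *%R c) @^-1` A) (`|c|%:E * F (c * x)%R))%E.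
Proof.
move=> c0 mA mF F0.
pose phi : measurableTypeR R -> measurableTypeR R := *%R c.
have mphi : measurable_fun [set: measurableTypeR R] phi.
  exact: mulrl_measurable.
pose k : {nonneg R} := NngNum (normr_ge0 c).
have mFA : measurable_fun A F by exact: measurable_funS mF.
have mFphi : measurable_fun (phi @^-1` A) (F \o phi).
  by apply: (@measurable_funS _ _ _ _ setT) => //; exact: measurableT_comp.
rewrite ge0_integralZl//; last exact: measurable_preimage_mull.
rewrite -(ge0_integral_pushforward mphi)//.
rewrite -(ge0_integral_mscale _ _ k)//.
apply: eq_measure_integral => B mB _ /=.
exact: lebesgue_measure_dilation.
Qed.

Lemma integral_dilation (c : R) (F : R -> \bar R) : c != 0 ->
  measurable_fun [set: R] F ->
  (\int[mu]_(x in [set: R]) F x =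
   \int[mu]_(x in [set: R]) (`|c|%:E * F (c * x)%R))%E.
Proof.
move=> c0 mF; rewrite integralE [RHS]integralE.
rewrite ge0_funeposM// ge0_funenegM//.
congr (_ - _)%E; rewrite (ge0_integral_dilation c0)// ?preimage_setT.
- by apply: eq_integral => x _; rewrite !funeposE.
- exact: measurable_funepos.
- by apply: eq_integral => x _; rewrite !funenegE.
- exact: measurable_funeneg.
Qed.

(** For [x - y = +oo - +oo] both sides are [-oo], which is why the factor has
    to be positive and the difference need not be well defined. *)
Lemma gt0_muleBr (r : R) (x y : \bar R) : 0 < r ->
  (r%:E * (x - y) = r%:E * x - r%:E * y)%E.
Proof.
move=> r0; have r0' : (0 < r%:E)%E by rewrite lte_fin.
by case: x y => [x| |] [y| |] //=;
  rewrite ?(gt0_muley r0') ?(gt0_muleNy r0')//= -?EFinM -?EFinD ?mulrBr.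
Qed.

(** Integrability is not assumed: a positive factor goes through [oo - oo] by
    [gt0_muleBr]. *)
Lemma gt0_integralZl (r : R) (F : R -> \bar R) : 0 < r ->
  measurable_fun [set: R] F ->
  (\int[mu]_(x in [set: R]) (r%:E * F x) =
   r%:E * \int[mu]_(x in [set: R]) F x)%E.
Proof.
move=> r0 mF; rewrite integralE [in RHS]integralE gt0_muleBr//.
rewrite ge0_funeposM ?ltW// ge0_funenegM ?ltW//.
by rewrite !ge0_integralZl ?lee_fin ?ltW//;
  [exact: measurable_funeneg | exact: measurable_funepos].
Qed.

End dilation.

(** * The density of a multiple of a random variable *)

Definition dilated_density (R : realType) (c : R) (g : R -> R) (x : R) : R :=
  `|c|^-1 * g (c^-1 * x).

Section dilated_density.
Context {R : realType}.
Local Notation mu := (@lebesgue_measure R).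
Variables (c : R) (g : R -> R).
Hypothesis c0 : c != 0.

Lemma dilated_densityK (x : R) : `|c| * dilated_density c g (c * x) = g x.
Proof. by rewrite /dilated_density mulVKf ?normr_eq0// mulKf. Qed.

Lemma measurable_dilated_density : measurable_fun [set: R] g ->
  measurable_fun [set: R] (dilated_density c g).
Proof.
move=> mg; apply: measurable_funM => //.
by apply: (measurableT_comp mg); exact: mulrl_measurable.
Qed.

Lemma integral_dilated_density (A : set R) : measurable_fun [set: R] g ->
  (forall x, 0 <= g x) -> measurable A ->
  (\int[mu]_(x in A) (dilated_density c g x)%:E =
   \int[mu]_(x in ( *%R c) @^-1` A) (g x)%:E)%E.
Proof.
move=> mg g0 mA; rewrite (ge0_integral_dilation c0)//.
- by under eq_integral do rewrite -EFinM dilated_densityK.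
- by apply/measurable_EFinP; exact: measurable_dilated_density.
- by move=> x; rewrite lee_fin mulr_ge0.
Qed.

Lemma prob_density_dilated : prob_density g ->
  prob_density (dilated_density c g).
Proof.
move=> [mg g0 g1]; split; first exact: measurable_dilated_density.
  by move=> x; rewrite mulr_ge0.
by rewrite integral_dilated_density.
Qed.

Lemma has_density_dilated (d : measure_display) (T : measurableType d)
    (P : probability T R) (Y : T -> R) : has_density P Y g ->
  has_density P (fun w => c * Y w) (dilated_density c g).
Proof.
move=> [mY gP gE]; have [mg g0 _] := gP.
split; [exact: measurable_funM | exact: prob_density_dilated |].
move=> A mA; rewrite integral_dilated_density//.
by rewrite -gE//; exact: measurable_preimage_mull.
Qed.

End dilated_density.

(** The event that [c X i j] lies in [A i j] for all [i], [j] is an event of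
    the same kind for [X], with the test sets divided by [c]. *)
Lemma random_matrix_dilated (R : realType) (c : R) (d : measure_display)
    (T : measurableType d) (P : probability T R) (n p : nat)
    (X : T -> 'M[R]_(n, p)) (g : 'I_n -> 'I_p -> R -> R) : c != 0 ->
  random_matrix_with_densities P X g ->
  random_matrix_with_densities P (fun w => c *: X w)
    (fun i j => dilated_density c (g i j)).
Proof.
move=> c0 [indX gX]; split=> [A mA | i j].
  transitivity (P [set w | forall i j, (( *%R c) @^-1` A i j) (X w i j)]).
    congr (P _); apply/seteqP; split=> w /= Aw i j; move: (Aw i j);
    by rewrite mxE.
  rewrite (indX (fun i j => ( *%R c) @^-1` A i j)) => [|i j]; last first.
    exact: measurable_preimage_mull.
  apply: eq_bigr => i _; apply: eq_bigr => j _; congr (P _).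
  by apply/seteqP; split=> w /=; rewrite mxE.
have -> : (fun w => (c *: X w) i j) = (fun w => c * X w i j).
  by apply/funext => w; rewrite mxE.
exact: has_density_dilated.
Qed.

(** * The objective under dilation *)

Section objective.
Context {R : realType}.
Variables (f : R -> R) (alpha : R).
Local Notation mu := (@lebesgue_measure R).

Lemma int_V_fC (g : R -> R) (a b s : R) :
  int_V_f f alpha g a b s = int_V_f f alpha g b a s.
Proof. by rewrite /int_V_f /V_f mulrC. Qed.

(** The sign of [c] is absorbed by the absolute value around the residual,
    since [Num.sqrt (c ^+ 2 * s) = `|c| * Num.sqrt s]. *)
Lemma V_f_dilation (c x a b s : R) : c != 0 ->
  V_f f alpha (c * x) (c * a) b (c ^+ 2 * s) =
  ((`|c| `^ (- alpha))%:E * V_f f alpha x a b s)%E.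
Proof.
move=> c0; rewrite /V_f sqrtrM ?sqr_ge0// sqrtr_sqr powRM// EFinM -muleA.
congr (_ * (_ * (_ - (_ * f _ `^ alpha)%:E)))%E.
by rewrite -mulrA -mulrBr !normrM !normfV normrM normr_id invfM mulrACA divff
  ?mul1r// normr_eq0.
Qed.

Lemma measurable_V_f (a b s : R) : measurable_fun [set: R] f ->
  measurable_fun [set: R] (fun x => V_f f alpha x a b s).
Proof.
move=> mf; apply: measurable_funeM; apply: emeasurable_funB => //.
apply/measurable_EFinP; apply: measurable_funM => //.
have mres : measurable_fun [set: R] (fun x : R => (x - a * b) / Num.sqrt s).
  by apply: measurable_funM => //; exact: measurable_funB.
have mabs := measurableT_comp (@normr_measurable R setT) mres.
exact: measurableT_comp (measurable_powR alpha) (measurableT_comp mf mabs).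
Qed.

Lemma int_V_f_dilation (c : R) (g : R -> R) (a b s : R) : c != 0 ->
  measurable_fun [set: R] f -> measurable_fun [set: R] g ->
  int_V_f f alpha (dilated_density c g) (c * a) b (c ^+ 2 * s) =
  ((`|c| `^ (- alpha))%:E * int_V_f f alpha g a b s)%E.
Proof.
move=> c0 mf mg; rewrite /int_V_f.
rewrite (integral_dilation c0); last first.
  apply: emeasurable_funM; first exact: measurable_V_f.
  by apply/measurable_EFinP; exact: measurable_dilated_density.
rewrite -gt0_integralZl ?powR_gt0 ?normr_gt0//; last first.
  apply: emeasurable_funM; first exact: measurable_V_f.
  exact/measurable_EFinP.
apply: eq_integral => x _.
by rewrite V_f_dilation// muleCA -EFinM dilated_densityK// -muleA.
Qed.

End objective.

Lemma is_argmin_scale (R : realType) (D D' : set R) (F G : R -> \bar R)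
    (r k x : R) : 0 < r -> k != 0 -> (forall y, D' (k * y) <-> D y) ->
  (forall y, G (k * y)%R = r%:E * F y)%E ->
  is_argmin D F x -> is_argmin D' G (k * x).
Proof.
move=> r0 k0 DD' GF [Dx Fx]; split=> [|y]; first exact/DD'.
rewrite -[y](mulVKf k0) => /DD' /Fx Fxy.
by rewrite !GF lee_pmul2l.
Qed.

Theorem theorem3p4 (R : realType) (d : measure_display) (T : measurableType d)
    (P : probability T R) (n p : nat)
    (f : R -> R) (hf : prob_density f) (hf_even : forall x, f x = f (- x))
    (alpha : R) (halpha : 0 < alpha)
    (X : T -> 'M[R]_(n, p)) (g : 'I_n -> 'I_p -> R -> R)
    (hX : random_matrix_with_densities P X g)
    (l : R) (u : 'I_n -> R) (v : 'I_p -> R) (sigma : R) (hsigma : 0 < sigma)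
    (hbest : best_fitting P f alpha X (Theta l u v (sigma ^+ 2)))
    (c : R) (hc : c != 0) :
  best_fitting P f alpha (fun w => c *: X w)
    (Theta (c * l) u v ((c * sigma) ^+ 2)).
Proof.
have [mf _ _] := hf.
have [h [hXh [s0 uv1 argu argv args]]] := hbest.
have mh i j : measurable_fun [set: R] (h i j).
  by have [_ []] := hXh.2 i j.
have r0 : 0 < `|c| `^ (- alpha) by rewrite powR_gt0 ?normr_gt0.
have c2 : 0 < c ^+ 2 by rewrite exprn_even_gt0.
have pos_c2 t : [set t | 0 < t] (c ^+ 2 * t) <-> [set t | 0 < t] t.
  by rewrite /= pmulr_rgt0.
exists (fun i j => dilated_density c (h i j)).
split; first exact: random_matrix_dilated.
rewrite exprMn; split; [exact: mulr_gt0 | exact: uv1 | | |] => i j.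
- rewrite -mulrA; apply: (is_argmin_scale r0 hc _ _ (argu i j)) => [|a].
    by [].
  exact: int_V_f_dilation.
- rewrite -mulrA; apply: (is_argmin_scale r0 hc _ _ (argv i j)) => [|b].
    by [].
  by rewrite [LHS]int_V_fC [in RHS]int_V_fC; exact: int_V_f_dilation.
- have [arg1 arg2] := args i j; have c2_neq0 := lt0r_neq0 c2.
  rewrite -[c * l * u i]mulrA -[c * l * v j]mulrA; split.
    apply: (is_argmin_scale r0 c2_neq0 pos_c2 _ arg1) => t.
    exact: int_V_f_dilation.
  apply: (is_argmin_scale r0 c2_neq0 pos_c2 _ arg2) => t.
  by rewrite [LHS]int_V_fC [in RHS]int_V_fC; exact: int_V_f_dilation.
Qed.
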